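(* Let $n\geq 9$ be an integer. For every integer $\lambda$ with $(n-2)/3\leq\lambda\leq 2n$ there exists an indecomposable $1$-factorization of $\lambda K_{2n}$ which is not simple.
   Context: The complete multigraph $\lambda K_{2n}$ has $2n$ vertices, and each pair of distinct vertices is joined by exactly $\lambda$ edges. A $1$-factor of $\lambda K_{2n}$ is a spanning subgraph consisting of $n$ pairwise independent edges (a perfect matching); two $1$-factors are regarded as equal if they consist of the same unordered pairs of vertices. A $1$-factorization of $\lambda K_{2n}$ is a partition of the edge-(multi)set of $\lambda K_{2n}$ into $1$-factors, i.e. a multiset of $1$-factors such that every pair of distinct vertices is covered exactly $\lambda$ times, counting multiplicities. A $1$-factorization is simple if no $1$-factor is repeated in it. It is decomposable if it is the (multiset) union of a $1$-factorization of $\lambda_0K_{2n}$ and a $1$-factorization of $(\lambda-\lambda_0)K_{2n}$ for some integer $\lambda_0$ with $1\le\lambda_0<\lambda$; otherwise it is indecomposable. *)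

(* Defs.v *)
From mathcomp Require Import all_boot all_order all_algebra.
From mathcomp Require Import finmap multiset.

Set Implicit Arguments.
Unset Strict Implicit.
Unset Printing Implicit Defensive.

Local Open Scope mset_scope.
Local Open Scope nat_scope.

(* The vertices of lambda K_{2n} are the elements of 'I_(2 * n).  An edge, up   *)
(* to parallelism, is a 2-element set of vertices: 1-factors with the same      *)
(* vertex pairs are identified, so parallel edges need not be distinguished.    *)

(* No explicit spanning condition: n disjoint pairs cover all 2n vertices.      *)
Definition one_factor (n : nat) (F : {set {set 'I_(2 * n)}}) : Prop :=
  [/\ forall e, e \in F -> #|e| = 2, trivIset F & #|F| = n].

(* The sum is the number of 1-factors of M containing the edge {x, y}, counted  *)
(* with multiplicity: M F is the multiplicity of F in M.                        *)
Definition one_factorization (n lambda : nat)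
    (M : {mset {set {set 'I_(2 * n)}}}) : Prop :=
  (forall F, F \in M -> one_factor F) /\
  (forall x y : 'I_(2 * n), x != y ->
     \sum_(F : {set {set 'I_(2 * n)}} | [set x; y] \in F) M F = lambda).

Definition simple (n : nat) (M : {mset {set {set 'I_(2 * n)}}}) : Prop :=
  forall F, M F <= 1.

Definition decomposable (n lambda : nat)
    (M : {mset {set {set 'I_(2 * n)}}}) : Prop :=
  exists (lambda0 : nat) (M1 M2 : {mset {set {set 'I_(2 * n)}}}),
    [/\ 1 <= lambda0 < lambda, one_factorization lambda0 M1,
        one_factorization (lambda - lambda0) M2 & M = M1 `+` M2].

(* Main.v *)
Require Import Defs.
From mathcomp Require Import all_boot all_order all_algebra.
From mathcomp Require Import finmap multiset.
From mathcomp Require Import ring zify.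

(** Split the vertices of K_{2n} into two levels indexed by Z = Z/n and let
    P_d be the 1-factor of the cross edges (x, 0)(x + d, 1).  For any h, the P_d
    with d <> h belong to a 1-factorization of K_{2n}: the reflections
    x |-> s - x cover the edges inside the two levels, and the points that they
    fix are joined across the levels by edges of P_h, which works for both
    parities of n ([level]).

    Choose a set S of differences with S and -S disjoint, put D = S u -S, and
    take h outside D u {0}.  Take every 1-factor other than P_0 and the P_d (d in D)
    lambda times, each P_d (d in D) only lambda - 1 times, and complete this
    with 1-factors F_t obtained from P_0 by swaps: exchanging x and x + s
    replaces two edges of P_0 by an edge of P_s and an edge of P_{-s}.  If each
    swap {x, x + s} (s in S) is made in exactly one F_t, where simultaneous swaps
    are disjoint, then each edge of P_d (d in D) is covered lambda times; each
    edge of P_0 is covered by all the F_t but 2|S| of them, so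
    lambda + 2|S| factors F_t are needed.  In other words, the F_t are the
    colours of a proper edge colouring, with lambda + 2|S| colours, of the
    Cayley graph of Z with respect to S.

    The result is indecomposable if every colour is used and one colour t0
    contains swaps of all the differences in S ([linked_indecomposable]).  A
    subfactorization covering each edge lambda0 times and containing P_d with
    multiplicity m(d) contains F_t exactly lambda0 - m(d) times as soon as t
    contains a swap of difference d or -d.  Through t0 this number is the same
    for all t, and it is 0 or 1, so one of two complementary subfactorizations
    contains no F_t; but the edges of P_0 lie in no other factor, so its
    lambda0 is 0.  The factorization is not simple because lambda >= 2 and some
    factors are repeated lambda times.

    It remains to colour.  The hypotheses force lambda >= 3.  For lambda <= n - 2
    the cycle (S = {1}) has a proper colouring with any number of colours from 5
    to n.  For n - 1 <= lambda <= 2n, S = {1, 2, 3} works: the n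
    colours consisting of three disjoint swaps {t, t + 1}, {t - 1, t + 2},
    {t + 3, t + 5} can be split one swap at a time, which gives any number of
    colours from n to 3n - 2. *)

Set Implicit Arguments.
Unset Strict Implicit.
Unset Printing Implicit Defensive.

Import Order.TTheory GRing.Theory Num.Theory.

Local Open Scope nat_scope.

(** * Perfect matchings as fixed-point-free involutions *)

Definition pairing (U : finType) (f : U -> U) : {set {set U}} :=
  [set [set x; f x] | x : U].

Section Pairing.
Variables (U : finType) (f : U -> U).
Hypotheses (fI : involutive f) (f_neq : forall x, f x != x).

Lemma mem_pairing x y : x != y -> ([set x; y] \in pairing f) = (f x == y).
Proof.
move=> nxy; apply/imsetP/eqP => [[z _ E]|<-]; last by exists x.
have: x \in [set z; f z] by rewrite -E set21.
have: y \in [set z; f z] by rewrite -E set22.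
rewrite !inE => /orP[]/eqP Ey /orP[]/eqP Ex; move: nxy;
  by rewrite Ex Ey ?fI ?eqxx.
Qed.

Lemma card_pairing_block e : e \in pairing f -> #|e| = 2.
Proof. by case/imsetP=> x _ ->; rewrite cards2 eq_sym f_neq. Qed.

Lemma pairing_blockE e z : e \in pairing f -> z \in e -> e = [set z; f z].
Proof.
case/imsetP=> x _ ->; rewrite !inE => /orP[]/eqP-> //.
by rewrite fI setUC.
Qed.

Lemma partition_pairing : partition (pairing f) [set: U].
Proof.
apply/and3P; split.
- apply/eqP/setP=> x; rewrite inE; apply/bigcupP; exists [set x; f x].
    exact: imset_f.
  by rewrite set21.
- apply/trivIsetP=> A B PA PB; apply: contraR => /pred0Pn[z /= /andP[zA zB]].
  by rewrite (pairing_blockE PA zA) (pairing_blockE PB zB).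
- by apply/negP=> /card_pairing_block; rewrite cards0.
Qed.

End Pairing.

Lemma pairing_one_factor n (f : 'I_(2 * n) -> 'I_(2 * n)) :
  involutive f -> (forall x, f x != x) -> one_factor (pairing f).
Proof.
move=> fI fn; have part := partition_pairing fI fn.
split; first exact: card_pairing_block.
  by case/and3P: part.
have := card_uniform_partition (card_pairing_block fn) part.
rewrite cardsT card_ord [RHS]mulnC => /eqP.
by rewrite eqn_pmul2l // eq_sym => /eqP.
Qed.

(** * Multisets given by a finite family with multiplicities *)

Definition mset_of_family (K : choiceType) (J : finType) (mu : J -> nat)
    (F : J -> K) : {mset K}%mset :=
  seq_mset (flatten [seq nseq (mu j) (F j) | j <- enum J]).

Lemma mset_of_familyE (K : choiceType) (J : finType) (mu : J -> nat)
    (F : J -> K) (a : K) :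
  mset_of_family mu F a = \sum_j mu j * (F j == a).
Proof.
rewrite mset_seqE count_flatten -map_comp sumnE big_map big_enum /=.
by apply: eq_bigr => j _; rewrite count_nseq mulnC.
Qed.

Lemma mem_mset_of_family (K : choiceType) (J : finType) (mu : J -> nat)
    (F : J -> K) (a : K) :
  a \in mset_of_family mu F -> exists2 j, 0 < mu j & F j = a.
Proof.
rewrite in_mset mset_of_familyE lt0n sum_nat_eq0 => /forallPn[j] /=.
by case: (F j =P a); rewrite ?muln0 // muln1 -lt0n => Fj mu_gt0; exists j.
Qed.

Lemma sum_mset_of_family (K J : finType) (mu : J -> nat) (F : J -> K)
    (P : pred K) :
  \sum_(a | P a) mset_of_family mu F a = \sum_j mu j * P (F j).
Proof.
under eq_bigr do rewrite mset_of_familyE.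
rewrite exchange_big; apply: eq_bigr => j _ /=; rewrite -big_distrr /=.
congr (_ * _); case PF: (P (F j)).
  rewrite (bigD1 (F j)) //= eqxx big1 ?addn0 // => a /andP[_].
  by rewrite eq_sym => /negPf->.
by rewrite big1 // => a Pa; case: eqP => // E; rewrite E Pa in PF.
Qed.

(** * A criterion for indecomposability *)

Local Notation factor n := {set {set 'I_(2 * n)}}.

(** If an edge lies in two factors T t and Q d only, the multiplicities of these
    two in a 1-factorization of lambda0 K_{2n} contained in M add up to lambda0.
    A member t0 related to every
    d thus forces all the T t to have the same multiplicity, at most 1, in the
    subfactorization: they go together into one of the two parts, and the other
    part has nothing left to cover the edge that only the T t contain. *)
Lemma linked_indecomposable (n lambda : nat) (M : {mset factor n}%mset)
    (I J : Type) (T : I -> factor n)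
    (Q : J -> factor n) (r : I -> J -> Prop) (t0 : I) :
  (forall t, M (T t) <= 1) ->
  (forall t, exists d, r t d) -> (forall d, r t0 d) ->
  (forall t d, r t d -> exists x y, [/\ x != y, [set x; y] \in T t,
     [set x; y] \in Q d, T t != Q d
   & forall F : factor n, [set x; y] \in F -> F \in M -> F = T t \/ F = Q d]) ->
  (exists x y : 'I_(2 * n), x != y /\
     forall F : factor n, [set x; y] \in F -> F \in M -> exists t, F = T t) ->
  ~ decomposable lambda M.
Proof.
move=> T1 r_ex r_t0 r_edge [x0 [y0 [nxy0 T_edge]]].
case=> l0 [M1 [M2 [/andP[l0_gt0 l0_lt] M1s M2s ME]]].
have sub (N : {mset factor n}%mset) F : (forall F, N F <= M F) -> F \notin M -> N F = 0.
  by move=> NM /mset_eq0P MF; have := NM F; rewrite MF leqn0 => /eqP.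
have TQ (N : {mset factor n}%mset) l t d : (forall F, N F <= M F) -> one_factorization l N ->
    r t d -> N (T t) + N (Q d) = l.
  move=> NM [_ Ns] /r_edge[x [y [nxy eT eQ nTQ eF]]]; rewrite -(Ns _ _ nxy).
  rewrite (bigD1 (T t)) //= (bigD1 (Q d)) /=; last by rewrite eQ eq_sym.
  rewrite big1 ?addn0 // => F /andP[/andP[eF' nT] nQ].
  apply: sub => //; apply/negP => /(eF _ eF')[] E; first by rewrite E eqxx in nT.
  by rewrite E eqxx in nQ.
have cst (N : {mset factor n}%mset) l t : (forall F, N F <= M F) -> one_factorization l N ->
    N (T t) = N (T t0).
  move=> NM Ns; have [d rd] := r_ex t.
  by apply/(@addIn (N (Q d))); rewrite !(TQ _ l).
have vanish (N : {mset factor n}%mset) l : (forall F, N F <= M F) -> one_factorization l N ->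
    N (T t0) = 0 -> l = 0.
  move=> NM Ns N0; rewrite -(Ns.2 _ _ nxy0) big1 // => F eF.
  have [/(T_edge _ eF)[t ->]|] := boolP (F \in M); last exact: sub.
  by rewrite (cst _ l).
have M1M F : M1 F <= M F by rewrite ME msetE2 leq_addr.
have M2M F : M2 F <= M F by rewrite ME msetE2 leq_addl.
have := T1 t0; rewrite ME msetE2.
have [/(vanish _ _ M1M M1s)|] := eqVneq (M1 (T t0)) 0; first by lia.
have [/(vanish _ _ M2M M2s)|] := eqVneq (M2 (T t0)) 0; first by lia.
by lia.
Qed.

(** * The two-level vertex set *)

Section Prism.
Variable Z : finZmodType.
Implicit Types (x y d e h s : Z).
Local Open Scope ring_scope.

(** For mutually inverse f and g, the involution that joins (x, false) to
    (f x, true). *)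
Definition cross (f g : Z -> Z) (v : Z * bool) : Z * bool :=
  if v.2 then (g v.1, false) else (f v.1, true).

Lemma cross_involutive f g : cancel f g -> cancel g f -> involutive (cross f g).
Proof. by move=> fK gK [x []]; rewrite /cross /= ?fK ?gK. Qed.

Lemma cross_neq f g v : cross f g v != v.
Proof. by case: v => x []; rewrite /cross xpair_eqE andbF. Qed.

(** On each level the reflection x |-> s - x is used, up to translation by h on
    the upper one; a fixed point x of the lower reflection corresponds to the
    fixed point x + h of the upper one, and the two are joined.  As s varies,
    each x is fixed once (s = x + x), so that together these involutions cover
    every edge inside a level and every cross edge of displacement h, once. *)
Definition level h s (v : Z * bool) : Z * bool :=
  if v.2 then
    let x := v.1 - h in
    if x + x == s then (x, false) else (s - x + h, true)
  else if v.1 + v.1 == s then (v.1 + h, true) else (s - v.1, false).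

Lemma reflection_fixed s x : (s - x + (s - x) == s) = (x + x == s).
Proof.
by rewrite addrACA -opprD subr_eq (inj_eq (addrI s)) eq_sym.
Qed.

Lemma level_involutive h s : involutive (level h s).
Proof.
case=> x []; rewrite /level /=; case Es: (_ + _ == s) => /=.
- by rewrite Es subrK.
- by rewrite addrK reflection_fixed Es subKr subrK.
- by rewrite addrK Es.
by rewrite reflection_fixed Es subKr.
Qed.

Lemma level_neq h s v : level h s v != v.
Proof.
case: v => x []; rewrite /level /=; case: ifP => Es; rewrite xpair_eqE ?andbF //.
  rewrite andbT; apply: contraFN Es => /eqP E.
  by rewrite -{2}E addrK addrC subrK.
by rewrite andbT; apply: contraFN Es => /eqP E; rewrite -{2}E addrC subrK.
Qed.

Lemma sum_level_cross h x y :
  (\sum_s (level h s (x, false) == (y, true)))%N = (y == x + h) :> nat.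
Proof.
rewrite (bigD1 (x + x)) //= big1 => [|s ns]; rewrite /level /=.
  by rewrite eqxx xpair_eqE andbT addn0 eq_sym.
by rewrite [x + x == s]eq_sym (negPf ns) xpair_eqE andbF.
Qed.

Lemma sum_level_flat h x y b : x != y ->
  (\sum_s (level h s (x, b) == (y, b)) = 1)%N.
Proof.
wlog ->: b x y / b = false => [IH|nxy].
  case: b => nxy; last exact: IH.
  rewrite -[RHS](IH false (x - h) (y - h)) ?(can_eq (subrK h)) //.
  apply: eq_bigr => s _; rewrite /level /=.
  by case: ifP => _; rewrite !xpair_eqE ?andbF // !andbT -[in RHS](inj_eq (addIr h)) subrK.
rewrite (bigD1 (x + y)) //= big1 => [|s ns]; rewrite /level /=.
  by rewrite (can_eq (addKr x)) (negPf nxy) addrC addKr eqxx.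
case: ifP => _; rewrite xpair_eqE ?andbF // andbT subr_eq addrC.
by rewrite (negPf ns).
Qed.

End Prism.

(** * The factorization attached to a family of involutions of the group *)

Section Construction.
Variables (n lambda L : nat) (Z : finZmodType) (D : {set Z}) (h : Z).
Variable pi : 'I_L -> Z -> Z.
Local Open Scope ring_scope.

Hypotheses (cardZ : #|Z| = n) (lambda_gt1 : (1 < lambda)%N).
Hypothesis cardL : L = (lambda + #|D|)%N.
Hypotheses (D0 : 0 \notin D) (D2 : forall d, d \in D -> d + d != 0).
Hypotheses (h0 : h != 0) (hD : h \notin D).
Hypothesis piI : forall t, involutive (pi t).
Hypothesis pi_count : forall x y, x != y ->
  (\sum_t (pi t x == y))%N = (y - x \in D) :> nat.
Hypothesis pi_moves : forall t, exists x, pi t x != x.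
Hypothesis pi_linked : exists t0, forall d, d \in D ->
  exists x, pi t0 x = x + d.

Let J : finType := ('I_L + (Z + Z))%type.

Let fam (j : J) : Z * bool -> Z * bool :=
  match j with
  | inl t => cross (pi t) (pi t)
  | inr (inl e) => cross (fun x => x + e) (fun x => x - e)
  | inr (inr s) => level h s
  end.

(* Multiplicity 0 for displacements 0 and h: their edges are covered by the
   members cross (pi t) (pi t) and level h s respectively. *)
Let mult (j : J) : nat :=
  match j with
  | inl _ => 1
  | inr (inl e) =>
      if e \in D then lambda.-1 else if (e == 0) || (e == h) then 0 else lambda
  | inr (inr _) => lambda
  end.

Let famI j : involutive (fam j).
Proof.
case: j => [t|[e|s]] /=; last exact: level_involutive.
  by apply: cross_involutive; apply: piI.
by apply: cross_involutive => x; rewrite (addrK, subrK).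
Qed.

Let fam_neq j v : fam j v != v.
Proof.
by case: j => [t|[e|s]] /=; [apply: cross_neq | apply: cross_neq | apply: level_neq].
Qed.

(* Each of the L involutions sends x somewhere, and exactly #|D| of them send
   it away from x. *)
Let pi_fixed x : (\sum_t (pi t x == x))%N = lambda.
Proof.
have: (\sum_y \sum_t (pi t x == y) = L)%N.
  rewrite exchange_big /= (eq_bigr (fun=> 1%N)) ?sum1_card ?card_ord // => t _.
  rewrite (bigD1 (pi t x)) //= eqxx big1 // => y.
  by rewrite eq_sym => /negPf->.
rewrite (bigD1 x) //= (eq_bigr (fun y => (y - x \in D) : nat)); last first.
  by move=> y; rewrite eq_sym; apply: pi_count.
suff -> : (\sum_(y | y != x) (y - x \in D)%R)%N = #|D|.
  by move=> E; apply/eqP; rewrite -(eqn_add2r #|D|) E -cardL.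
rewrite -sum1_card [RHS](reindex_onto (fun y => y - x) (fun d => d + x)) /=;
  last by move=> d _; rewrite addrK.
rewrite big_mkcond [RHS]big_mkcond; apply: eq_bigr => y _.
rewrite subrK eqxx andbT; case: eqP => [->|_] /=; last by case: (_ \in _).
by rewrite subrr (negPf D0).
Qed.

Let sum_shift (x y : Z) :
  (\sum_e mult (inr (inl e)) * (x + e == y)%R)%N = mult (inr (inl (y - x))).
Proof.
rewrite (bigD1 (y - x)) //= big1 => [|e ne].
  by rewrite [x + _]addrC subrK eqxx muln1 addn0.
by case: (x + e =P y) => [E|_]; [rewrite -E addrC addKr eqxx in ne | rewrite muln0].
Qed.

Let sum_cross (x y : Z) :
  (\sum_j mult j * (fam j (x, false) == (y, true)))%N = lambda.
Proof.
rewrite !big_sumType /=.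
under eq_bigr do rewrite mul1n xpair_eqE andbT.
under [X in (_ + (X + _))%N]eq_bigr do rewrite xpair_eqE andbT.
rewrite -big_distrr sum_level_cross sum_shift /=.
have [<-|nxy] := eqVneq x y.
  rewrite pi_fixed subrr (negPf D0) eqxx /= -[x in x == _]addr0 (inj_eq (addrI x)).
  by rewrite eq_sym (negPf h0) muln0 !addn0.
rewrite pi_count // [x + h]addrC -subr_eq.
rewrite subr_eq0 [y == x]eq_sym (negPf nxy) /=.
case: ifP => [yD|_]; last by case: eqP; rewrite ?muln1 ?muln0 ?addn0.
by case: eqP => [E|_]; [case/negP: hD; rewrite -E | rewrite muln0 addn0; lia].
Qed.

Let sum_flat (x y : Z) b : x != y ->
  (\sum_j mult j * (fam j (x, b) == (y, b)))%N = lambda.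
Proof.
move=> nxy; rewrite !big_sumType /= big1 => [|t _]; last first.
  by rewrite /cross /=; case: b; rewrite xpair_eqE andbF muln0.
rewrite big1 ?add0n => [|t _]; last first.
  by rewrite /cross /=; case: b; rewrite xpair_eqE andbF muln0.
by rewrite -big_distrr /= sum_level_flat // muln1.
Qed.

Let fam_cover v w : v != w -> (\sum_j mult j * (fam j v == w))%N = lambda.
Proof.
case: v w => [x b] [y c] nvw; have [E|nbc] := eqVneq b c.
  by rewrite -E sum_flat //; apply: contraNneq nvw => ->; rewrite E.
case: b c nbc {nvw} => [] [] // _.
by under eq_bigr do rewrite (inv_eq (famI _)) eq_sym.
Qed.

Let cardV : #|{: Z * bool}| = (2 * n)%N.
Proof. by rewrite card_prod card_bool cardZ mulnC. Qed.

Let lab (v : Z * bool) : 'I_(2 * n) := cast_ord cardV (enum_rank v).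
Let unlab (x : 'I_(2 * n)) : Z * bool := enum_val (cast_ord (esym cardV) x).

Let labK : cancel lab unlab.
Proof. by move=> v; rewrite /lab /unlab cast_ordK enum_rankK. Qed.
Let unlabK : cancel unlab lab.
Proof. by move=> x; rewrite /lab /unlab enum_valK cast_ordKV. Qed.

Let fac j : factor n := pairing (lab \o fam j \o unlab).

Let facI j : involutive (lab \o fam j \o unlab).
Proof. by move=> x /=; rewrite labK famI unlabK. Qed.

Let fac_neq j x : (lab \o fam j \o unlab) x != x.
Proof. by rewrite /= -(can_eq unlabK) labK fam_neq. Qed.

Let mem_fac j x y : x != y ->
  ([set x; y] \in fac j) = (fam j (unlab x) == unlab y).
Proof.
by move=> nxy; rewrite mem_pairing //= -(can_eq unlabK) labK.
Qed.

(** The involutions [pi t] play the role of the sets of simultaneous swaps; the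
    difference of an edge that they create lies in D, and each such edge is
    created exactly once. *)
Lemma indecomposable_of_involutions :
  exists M : {mset factor n}%mset,
    [/\ one_factorization lambda M, ~ decomposable lambda M & ~ simple M].
Proof.
pose M := mset_of_family mult fac.
have Mfact : one_factorization lambda M.
  split=> [F /mem_mset_of_family[j _ <-]|x y nxy].
    exact: pairing_one_factor.
  rewrite sum_mset_of_family.
  under eq_bigr do rewrite mem_fac //.
  by apply: fam_cover; rewrite (can_eq unlabK).
have cross_mem j x y :
    ([set lab (x, false); lab (y, true)] \in fac j)
      = (fam j (x, false) == (y, true)).
  by rewrite mem_fac ?labK // (can_eq labK) xpair_eqE andbF.
have M_fac j : (mult j <= M (fac j))%N.
  rewrite mset_of_familyE (bigD1 j) //= eqxx muln1; exact: leq_addr.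
exists M; split=> //; last first.
  move=> /(_ (fac (inr (inr 0)))); apply/negP; rewrite -ltnNge.
  exact: leq_trans (M_fac (inr (inr 0))).
pose T t := fac (inl t); pose Q (d : Z) := fac (inr (inl d)).
have edge t x d : d \in D -> pi t x = x + d ->
    [/\ lab (x, false) != lab (x + d, true),
        [set lab (x, false); lab (x + d, true)] \in T t,
        [set lab (x, false); lab (x + d, true)] \in Q d, T t != Q d
      & forall F : factor n, [set lab (x, false); lab (x + d, true)] \in F ->
          F \in M -> F = T t \/ F = Q d].
  move=> dD pix; split.
  - by rewrite (can_eq labK) xpair_eqE andbF.
  - by rewrite cross_mem /= /cross /= pix.
  - by rewrite cross_mem /= /cross.
  (* T t contains the second edge created by the swap, of displacement - d. *)
  - apply/eqP=> TQ; have: [set lab (x + d, false); lab (x, true)] \in T t.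
      by rewrite cross_mem /= /cross /= -pix piI.
    rewrite TQ cross_mem /= /cross xpair_eqE /= andbT -addrA -subr_eq0.
    by rewrite addrAC subrr add0r (negPf (D2 dD)).
  move=> F eF /mem_mset_of_family[j mu_j Fj]; rewrite -Fj in eF *.
  rewrite cross_mem in eF; case: j mu_j eF {Fj} => [t'|[e|s]] /= mu_j.
  - rewrite /cross xpair_eqE /= andbT => /eqP pit'; left.
    have nx : x != x + d.
      rewrite -subr_eq0 opprD addrA subrr add0r oppr_eq0.
      by apply: contraNneq D0 => <-.
    have := pi_count nx; rewrite addrAC subrr add0r dD.
    case: (eqVneq t' t) => [-> //|nt].
    by rewrite (bigD1 t) //= (bigD1 t') //= pix pit' !eqxx.
  - by rewrite /cross xpair_eqE /= andbT (inj_eq (addrI x)) => /eqP->; right.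
  rewrite /level /=; case: ifP => _; rewrite xpair_eqE ?andbF //.
  by rewrite andbT (inj_eq (addrI x)) => /eqP E; case/negP: hD; rewrite E.
have [t0 link] := pi_linked.
have moved t : exists x d, d \in D /\ pi t x = x + d.
  have [x nx] := pi_moves t; exists x, (pi t x - x); rewrite [x + _]addrC subrK; split=> //.
  have := pi_count (y := pi t x) (x := x); rewrite eq_sym nx => /(_ isT).
  by case: (_ \in D) => //; rewrite (bigD1 t) //= eqxx.
apply: (@linked_indecomposable n lambda M 'I_L {d | d \in D} T (fun d => Q (val d))
  (fun t d => exists x, pi t x = x + val d) t0).
(* An edge of displacement d in T t is also covered by the lambda.-1 copies of
   Q d, which leaves room for a single T t. *)
- move=> t; have [x [d [dD pix]]] := moved t.
  have [nxy eT eQ nTQ _] := edge _ _ _ dD pix.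
  have := M_fac (inr (inl d)); rewrite /= dD -/(Q d).
  have := Mfact.2 _ _ nxy; rewrite (bigD1 (T t)) //= (bigD1 (Q d)) /=; last first.
    by rewrite eQ eq_sym.
  by lia.
- by move=> t; have [x [d [dD pix]]] := moved t; exists (Sub d dD); exists x.
- by case=> d dD /=; apply: link.
- case=> t lt [d dD] /= [x pix].
  by exists (lab (x, false)), (lab (x + d, true)); apply: edge.
exists (lab (0, false)), (lab (0, true)); split.
  by rewrite (can_eq labK) xpair_eqE andbF.
move=> F eF /mem_mset_of_family[j mu_j Fj]; rewrite -Fj in eF *.
rewrite cross_mem in eF; case: j mu_j eF {Fj} => [t|[e|s]] /=.
- by exists t.
- rewrite /cross xpair_eqE /= andbT add0r => mu_e /eqP E.
  by rewrite E (negPf D0) eqxx in mu_e.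
rewrite /level /= => _; case: ifP => _; rewrite xpair_eqE ?andbF //.
by rewrite andbT add0r (negPf h0).
Qed.

End Construction.

(** * From proper colourings of the swaps to involutions *)

Section SwapColoring.
Variables (n lambda L : nat) (Z : finZmodType) (S : {set Z}) (h : Z).
Variable c : Z -> Z -> nat.
Local Open Scope ring_scope.

Hypotheses (cardZ : #|Z| = n) (lambda_gt1 : (1 < lambda)%N).
Hypothesis cardL : L = (lambda + 2 * #|S|)%N.
Hypothesis S_asym : forall s, s \in S -> - s \notin S.
Hypotheses (h0 : h != 0) (hS : h \notin S) (hNS : - h \notin S).
Hypothesis c_out : forall x, {in S &, injective (c x)}.
Hypothesis c_in : forall x, {in S &, injective (fun s => c (x - s) s)}.
Hypothesis c_in_out : forall x s s', s \in S -> s' \in S ->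
  c x s != c (x - s') s'.
Hypothesis c_lt : forall x s, s \in S -> (c x s < L)%N.
Hypothesis c_onto : forall t, (t < L)%N -> exists x s, s \in S /\ c x s = t.
Hypothesis c_linked : exists2 t, (t < L)%N & forall s, s \in S -> exists x, c x s = t.

Let D := [set d | (d \in S) || (- d \in S)].

(* The colour of the swap {x, x + d}, which has difference d seen from x and - d
   seen from x + d, whereas c takes differences in S only. *)
Let col (x d : Z) := if d \in S then c x d else c (x + d) (- d).

Let S0 : 0 \notin S.
Proof. by apply/negP=> S0; move: (S_asym S0); rewrite oppr0 S0. Qed.

Let DN d : (- d \in D) = (d \in D).
Proof. by rewrite !inE opprK orbC. Qed.

Let colN x d : d \in D -> col (x + d) (- d) = col x d.
Proof.
rewrite inE /col; have [dS _|/= _ ->//] := boolP (d \in S).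
by rewrite (negPf (S_asym dS)) addrK opprK.
Qed.

Let col_inj x : {in D &, injective (col x)}.
Proof.
move=> d e; rewrite !inE /col.
have [dS _|dS /= NdS] := boolP (d \in S); have [eS _|eS /= NeS] := boolP (e \in S).
- exact: c_out.
- by move=> /eqP; rewrite -[in x + e](opprK e) (negPf (c_in_out _ _ _)).
- by move=> /esym/eqP; rewrite -[in x + d](opprK d) (negPf (c_in_out _ _ _)).
rewrite -[in x + d](opprK d) -[in x + e](opprK e) => /(c_in NdS NeS).
exact: oppr_inj.
Qed.

Let col_lt x d : d \in D -> (col x d < L)%N.
Proof. by rewrite inE /col; case: ifP => [dS _|_ /= NdS]; apply: c_lt. Qed.

Let pi (t : 'I_L) (x : Z) : Z :=
  x + odflt 0 [pick d in D | col x d == t].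

Let piE (t : 'I_L) x d : d \in D -> col x d = t -> pi t x = x + d.
Proof.
move=> dD dt; rewrite /pi; case: pickP => [e /= /andP[eD /eqP et]|/(_ d)].
  by congr (_ + _); apply: (@col_inj x) => //; rewrite et dt.
by rewrite /= dD dt eqxx.
Qed.

Variant pi_spec (t : 'I_L) x : Z -> Prop :=
  | PiMoves d of d \in D & col x d = t : pi_spec t x (x + d)
  | PiFixes of (forall d, d \in D -> col x d != t) : pi_spec t x x.

Let piP t x : pi_spec t x (pi t x).
Proof.
rewrite /pi; case: pickP => [d /= /andP[dD /eqP dt]|none]; first exact: PiMoves.
by rewrite addr0; apply: PiFixes => d dD; have /negbT := none d; rewrite dD.
Qed.

Let piI t : involutive (pi t).
Proof.
move=> x; case: (pi t x) / (piP t x) => [d dD dt|none].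
  by rewrite (@piE t _ (- d)) ?DN ?colN // addrK.
by case: (pi t x) / (piP t x) => // d dD dt; case/eqP: (none d dD).
Qed.

Let pi_count x y : x != y -> (\sum_t (pi t x == y))%N = (y - x \in D) :> nat.
Proof.
move=> nxy; have addxB : x + (y - x) = y by rewrite addrC subrK.
have pi_y t : pi t x = y -> y - x \in D /\ col x (y - x) = t.
  case: (pi t x) / (piP t x) => [d dD dt <-|_ E]; last by rewrite E eqxx in nxy.
  by rewrite addrC addKr.
have [yD|yD] := boolP (y - x \in D); last first.
  by rewrite big1 // => t _; case: eqP => // /pi_y[]; rewrite (negPf yD).
rewrite (bigD1 (Ordinal (col_lt x yD))) //= (@piE _ _ (y - x)) // addxB eqxx.
rewrite big1 // => t nt; case: (pi t x =P y) => // /pi_y[_ E].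
by case/eqP: nt; apply: val_inj.
Qed.

Let D0 : 0 \notin D.
Proof. by rewrite inE oppr0 orbb. Qed.

Let cardD : #|D| = (2 * #|S|)%N.
Proof.
have -> : D = S :|: (-%R @^-1: S) by apply/setP=> d; rewrite !inE.
rewrite cardsU card_preimset; last exact: oppr_inj.
suff -> : S :&: (-%R @^-1: S) = set0 by rewrite cards0 subn0 mul2n addnn.
by apply/setP=> d; rewrite !inE; apply/andP=> -[/S_asym/negPf->].
Qed.

(** Here [c x s] is the colour of the swap {x, x + s}.  The swaps at x are the
    {x, x + s} and the {x - s, x} for s in S; [c_out], [c_in] and [c_in_out] say
    that they have different colours, so the swaps of a given colour form an
    involution of Z. *)
Lemma indecomposable_of_swap_coloring :
  exists M : {mset factor n}%mset,
    [/\ one_factorization lambda M, ~ decomposable lambda M & ~ simple M].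
Proof.
apply: (@indecomposable_of_involutions n lambda L Z D h pi) => //.
- by rewrite cardD.
- move=> d; rewrite inE => dD; rewrite addr_eq0; apply: contraTneq dD => E.
  rewrite -E orbb; apply/negP=> dS; have := S_asym dS.
  by rewrite -E dS.
- by rewrite inE negb_or hS.
- move=> t; have [x [s [sS st]]] := c_onto (ltn_ord t); exists x.
  have sD : s \in D by rewrite inE sS.
  rewrite (@piE t _ s) // /col ?sS // -subr_eq0 addrC addKr.
  by apply: contraNneq S0 => <-.
have [t lt link] := c_linked; exists (Ordinal lt) => d dD.
move: (dD); rewrite inE; have [dS _|_ /= NdS] := boolP (d \in S).
  by have [x xt] := link _ dS; exists x; apply: piE => //; rewrite /col dS.
have [x xt] := link _ NdS; exists (x - d); apply: piE => //.
by rewrite /= -xt -(colN _ dD) subrK /col NdS.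
Qed.

End SwapColoring.

(** * Colourings over the cyclic group *)

Section CyclicGroup.
Variable m : nat.
Local Notation n := (m.+2).
Local Notation Z := ('Z_n).
Local Open Scope ring_scope.

Let natZ_inj i j : (i < n)%N -> (j < n)%N -> i%:R = j%:R :> Z -> i = j.
Proof.
by move=> ilt jlt /(congr1 val) /=; rewrite !val_Zp_nat // !modn_small.
Qed.

Let valS (y : Z) : (y + 1 : Z) = (if y.+1 == n then 0%N else y.+1) :> nat.
Proof.
have ylt : (y < n)%N := ltn_ord y.
rewrite -[in LHS](natr_Zp y) natr1 val_Zp_nat //.
by case: eqP => [->|ny]; [rewrite modnn | rewrite modn_small //; lia].
Qed.

(** The case S = {1, ..., k} of [indecomposable_of_swap_coloring], with colour 0
    as the linking colour and h = k + 1; the bound on k makes S and -S disjoint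
    and keeps h out of their union. *)
Lemma indecomposable_of_cyclic_coloring lambda k (c : Z -> nat -> nat) :
  (1 < lambda)%N -> (0 < k)%N -> (k.*2.+1 < n)%N ->
  (forall x i j, 0 < i <= k -> 0 < j <= k -> c x i = c x j -> i = j)%N ->
  (forall x i j, (0 < i <= k)%N -> (0 < j <= k)%N ->
     c (x - i%:R) i = c (x - j%:R) j -> i = j) ->
  (forall x i j, (0 < i <= k)%N -> (0 < j <= k)%N ->
     c (x + j%:R) i != c x j) ->
  (forall x i, (0 < i <= k)%N -> (c x i < lambda + k.*2)%N) ->
  (forall t, (t < lambda + k.*2)%N ->
     exists x i, (0 < i <= k)%N /\ c x i = t) ->
  (forall i, (0 < i <= k)%N -> exists x, c x i = 0%N) ->
  exists M : {mset factor n}%mset,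
    [/\ one_factorization lambda M, ~ decomposable lambda M & ~ simple M].
Proof.
move=> lambda_gt1 k_gt0 k_lt c_out c_in c_in_out c_lt c_onto c_linked.
have natZ_neq0 i : (0 < i < n)%N -> i%:R != 0 :> Z.
  move=> i_bd; apply/eqP => i0; have: i = 0%N by apply: natZ_inj => //; lia.
  lia.
pose S : {set Z} := [set (i.+1)%:R | i : 'I_k].
have memS i : (0 < i <= k)%N -> i%:R \in S.
  case: i => // i lt_ik.
  exact: (imset_f (fun i : 'I_k => i.+1%:R) (x := Ordinal lt_ik)).
have inS s : s \in S -> exists2 i, (0 < i <= k)%N & s = i%:R.
  by case/imsetP=> i _ ->; exists i.+1 => //=; apply: ltn_ord.
have val_i i : (0 < i <= k)%N -> (i%:R : Z) = i :> nat.
  by move=> i_bd; rewrite val_Zp_nat // modn_small //; lia.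
have cardS : #|S| = k.
  rewrite card_imset ?card_ord // => i j /natZ_inj E; apply: val_inj.
  have := ltn_ord i; have := ltn_ord j => jk ik; apply: succn_inj; apply: E; lia.
apply: (@indecomposable_of_swap_coloring n lambda (lambda + k.*2) Z S (k.+1)%:R
  (fun x s => c x s)) => //.
- by rewrite card_ord.
- by rewrite cardS mul2n.
- move=> _ /inS[i i_bd ->]; apply/negP => /inS[j j_bd /eqP].
  by rewrite eq_sym -addr_eq0 -natrD (negPf (natZ_neq0 _ _)) //; lia.
- by rewrite natZ_neq0 //; lia.
- apply/negP=> /inS[i i_bd /natZ_inj]; lia.
- apply/negP=> /inS[i i_bd /eqP].
  by rewrite eq_sym -addr_eq0 -natrD (negPf (natZ_neq0 _ _)) //; lia.
- move=> x _ _ /inS[i i_bd ->] /inS[j j_bd ->]; rewrite !val_i //.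
  by move/c_out => ->.
- move=> x _ _ /inS[i i_bd ->] /inS[j j_bd ->] /=; rewrite !val_i //.
  by move/c_in => ->.
- move=> x _ _ /inS[i i_bd ->] /inS[j j_bd ->]; rewrite !val_i //.
  by rewrite -[in c x i](subrK j%:R x) c_in_out.
- by move=> x _ /inS[i i_bd ->]; rewrite val_i // c_lt.
- move=> t /c_onto[x [i [i_bd <-]]]; exists x, i%:R.
  by rewrite memS // val_i.
exists 0%N; first by lia.
by move=> _ /inS[i i_bd ->]; rewrite val_i //; apply: c_linked.
Qed.

(** The first lambda + 2 edges of the cycle get different colours and the other
    ones alternate between colours 1 and 2, so that the last edge never meets the
    colour 0 of the first one.  With a single difference, every
    colour is a linking one. *)
Lemma indecomposable_one_difference lambda : (1 < m)%N -> (3 <= lambda <= m)%N ->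
  exists M : {mset factor n}%mset,
    [/\ one_factorization lambda M, ~ decomposable lambda M & ~ simple M].
Proof.
move=> m_gt1 /andP[lge lle].
pose c (x : Z) (i : nat) := if (x < lambda.+2)%N then x : nat else (odd x).+1.
apply: (@indecomposable_of_cyclic_coloring lambda 1 c) => //.
- by lia.
- by move=> x i j; lia.
- by move=> x i j; lia.
- move=> y i j _ j_bd; have -> : j = 1%N by lia.
  have ylt : (y < n)%N := ltn_ord y.
  rewrite /c valS; case: (_.+1 =P _) => ? /=; do 2?case: ifP => ?; lia.
- by move=> x i _; rewrite /c; case: ifP => ?; lia.
- move=> t t_lt; have tn : (t < n)%N by lia.
  by exists (Ordinal tn), 1%N; rewrite /c /= ifT //; lia.
by move=> i _; exists 0.
Qed.


(** Colour t < n contains {t, t + 1}, and by default also {t + 3, t + 5} and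
    {t - 1, t + 2}.  These last two kinds of swaps, taken in this order for
    t = 1, ..., n - 1, receive the colours n, n + 1, ... instead as long as new
    colours are needed; colour 0 is kept whole to link the three differences.
    In all cases the colour of a swap determines the t that it comes from
    ([unpaint]), and the six swaps at a vertex x come from t = x - 5, ..., x + 1
    without x - 4: this makes the colouring proper. *)
Lemma indecomposable_three_differences lambda : (7 <= m)%N ->
  (m - 4 <= lambda <= (m.+1).*2 + m - 4)%N ->
  exists M : {mset factor n}%mset,
    [/\ one_factorization lambda M, ~ decomposable lambda M & ~ simple M].
Proof.
move=> m_ge /andP[lge lle]; have lambda_gt1 : (1 < lambda)%N by lia.
pose r := (lambda + 6 - n)%N.
pose paint (b : nat) (t : Z) := let u := (b * m.+1 + t.-1)%N in
  if (0 < t)%N && (u < r)%N then (n + u)%N else t : nat.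
pose c (x : Z) (i : nat) :=
  match i with
  | 1 => x : nat
  | 2 => paint 0 (x - 3%:R)
  | _ => paint 1 (x + 1)
  end.
pose unpaint (u : nat) : Z :=
  if (u < n)%N then u%:R else (((u - n) %% m.+1).+1)%:R.
have paintK b t : unpaint (paint b t) = t.
  have tlt : (t < n)%N := ltn_ord t.
  rewrite /paint; case: ifP => [/andP[t_gt0 _]|_]; rewrite /unpaint.
    rewrite ifN; last by lia.
    rewrite addKn modnMDl modn_small ?prednK ?natr_Zp //; lia.
  by rewrite tlt natr_Zp.
(* t = x - 5 + out i for the swap {x, x + i}, and t = x - 5 + inn i for
   {x - i, x}; entry 0 of the tables is a dummy. *)
pose out i := nth 0%N [:: 0; 5; 2; 6]%N i.
pose inn i := nth 0%N [:: 0; 4; 0; 3]%N i.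
have bd i : (0 < i <= 3)%N -> [\/ i = 1, i = 2 | i = 3]%N.
  by case: i => [|[|[|[|i]]]] //= _; [constructor 1|constructor 2|constructor 3].
have unpaint_out x i : (0 < i <= 3)%N -> unpaint (c x i) = x - 5%:R + (out i)%:R.
  case/bd=> ->; rewrite /c ?paintK /out /=; [|ring|ring].
  by rewrite /unpaint (ltn_ord x : (x < n)%N) natr_Zp; ring.
have unpaint_in x i : (0 < i <= 3)%N ->
    unpaint (c (x - i%:R) i) = x - 5%:R + (inn i)%:R.
  move=> i_bd; rewrite unpaint_out //.
  by case/bd: i_bd => ->; rewrite /out /inn /=; ring.
have cast_inj x i j : (i < 7)%N -> (j < 7)%N ->
    x + i%:R = x + j%:R :> Z -> i = j.
  by move=> i7 j7 /addrI/natZ_inj; apply; lia.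
have paint_lt b t : (b <= 1)%N -> (paint b t < n + r)%N.
  have tlt : (t < n)%N := ltn_ord t.
  by rewrite /paint; case: ifP => ?; lia.
have nr : (lambda + 3.*2 = n + r)%N by lia.
apply: (@indecomposable_of_cyclic_coloring lambda 3 c) => //.
- by lia.
- move=> x i j i_bd j_bd /(congr1 unpaint); rewrite !unpaint_out //.
  by move/cast_inj; case/bd: i_bd => ->; case/bd: j_bd => -> // /(_ isT isT).
- move=> x i j i_bd j_bd /(congr1 unpaint); rewrite !unpaint_in //.
  by move/cast_inj; case/bd: i_bd => ->; case/bd: j_bd => -> // /(_ isT isT).
- move=> x i j i_bd j_bd; rewrite -[x in c x j](addrK j%:R).
  apply/eqP => /(congr1 unpaint); rewrite unpaint_out // unpaint_in //.
  by move/cast_inj; case/bd: i_bd => ->; case/bd: j_bd => -> // /(_ isT isT).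
- move=> x i /bd[] ->; rewrite nr /c ?paint_lt //.
  by have xlt : (x < n)%N := ltn_ord x; lia.
- move=> t; rewrite nr => t_lt; have [tn|tn] := ltnP t n.
    by exists (Ordinal tn), 1%N.
  pose b := ((t - n) %/ m.+1)%N.
  have u_lt : (((t - n) %% m.+1).+1 < n)%N by rewrite ltnS ltn_mod.
  have b_le : (b < 2)%N by rewrite ltn_divLR //; lia.
  have paint_t : paint b (Ordinal u_lt) = t.
    by rewrite /paint /= -divn_eq ifT; lia.
  case: b b_le paint_t => [|[|//]] _ paint_t.
    by exists (Ordinal u_lt + 3%:R), 2%N; rewrite /c addrK.
  by exists (Ordinal u_lt - 1), 3%N; rewrite /c subrK.
move=> i /bd[] ->.
- by exists 0.
- by exists 3%:R; rewrite /c subrr.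
by exists (- 1); rewrite /c addNr.
Qed.

End CyclicGroup.

Theorem theorem1 (n : nat) (hn : (9 <= n)%N) (lambda : nat)
    (hlow : ((n%:R - 2%:R) / 3%:R <= lambda%:R :> rat)%R)
    (hup : (lambda <= 2 * n)%N) :
  exists M : {mset {set {set 'I_(2 * n)}}}%mset,
    [/\ one_factorization lambda M, ~ decomposable lambda M & ~ simple M].
Proof.
have low : (n <= 3 * lambda + 2)%N.
  move: hlow; rewrite ler_pdivrMr ?ltr0n // lerBlDr -natrM -natrD ler_nat.
  by rewrite mulnC.
case: n hn hlow hup low => [|[|m]] // hn _ hup low.
have [lambda_le|lambda_gt] := leqP lambda m.
  by apply: indecomposable_one_difference; lia.
by apply: indecomposable_three_differences; lia.
Qed.
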